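(* For any $k\in\{1,\ldots,n\}$ the extremal $k$-growth rate functions $\underline{\lambda}_k,\overline{\lambda}_k:\mathcal{LP}(\mathbb{I},\mathbb{R}^n)\to\mathbb{R}$ are Lipschitz continuous with Lipschitz constant $1$ with respect to the metric $d_{\mathbb{I}}$ on $\mathcal{LP}(\mathbb{I},\mathbb{R}^n)$.
   Context: Let $n\ge 1$, let $|\cdot|$ be an arbitrary fixed norm on $\mathbb{R}^n$ with unit sphere $\mathcal{S}$ and induced operator norm $\|\cdot\|$. Let $\mathbb{I}\subset\mathbb{R}$ be compact (not necessarily an interval), $t_-=\min\mathbb{I}$, $t_+=\max\mathbb{I}$, $t_-<t_+$. Put $\mathbb{I}^2_{\neq}=\{(t,s)\in\mathbb{I}\times\mathbb{I}: t\neq s\}$ and let $\overline{\mathbb{I}^2_{\neq}}$ be its closure in $\mathbb{R}^2$. A linear process on $\mathbb{I}$ is a family $\Phi(t,s)\in GL(n,\mathbb{R})$, $t,s\in\mathbb{I}$, such that $(t,s,x)\mapsto\Phi(t,s)x$ is continuous, $\Phi(t,t)=\mathrm{id}$, $\Phi(t,s)\Phi(s,r)=\Phi(t,r)$ for all $t,s,r\in\mathbb{I}$, and $t\mapsto\Phi(t,s)$ is Lipschitz continuous in operator norm for every $s\in\mathbb{I}$. For continuous $f:\mathbb{I}\to(0,\infty)$ let $\Delta(f)(t,s)=\frac{\ln f(t)-\ln f(s)}{t-s}$, $(t,s)\in\mathbb{I}^2_{\neq}$. Standing assumption: $\mathcal{LP}(\mathbb{I},\mathbb{R}^n)$ denotes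 the set of linear processes $\Phi$ on $\mathbb{I}$ for which $(x,t,s)\mapsto\Delta(|\Phi(\cdot,t_-)x|)(t,s)$ extends continuously from $\mathcal{S}\times\mathbb{I}^2_{\neq}$ to $\mathcal{S}\times\overline{\mathbb{I}^2_{\neq}}$; the extension is denoted by the same symbol. $\mathrm{Gr}(k,\mathbb{R}^n)$ is the set of $k$-dimensional subspaces of $\mathbb{R}^n$. For a subspace $X\neq\{0\}$, $\underline{\lambda}(X,\Phi)$ and $\overline{\lambda}(X,\Phi)$ are the minimum and the maximum, respectively, of $\Delta(|\Phi(\cdot,t_-)x|)(t,s)$ over $x\in X\cap\mathcal{S}$, $(t,s)\in\overline{\mathbb{I}^2_{\neq}}$. Extremal growth rates, $k\in\{1,\ldots,n\}$: $\underline{\lambda}_k(\Phi)=\max_{X\in\mathrm{Gr}(k,\mathbb{R}^n)}\underline{\lambda}(X,\Phi)$ and $\overline{\lambda}_k(\Phi)=\min_{X\in\mathrm{Gr}(k,\mathbb{R}^n)}\overline{\lambda}(X,\Phi)$ (the extrema are attained). Metric: for $\Phi,\Psi\in\mathcal{LP}(\mathbb{I},\mathbb{R}^n)$, $$\tilde d_{\mathbb{I}}(\Phi,\Psi)=\sup_{X\in\mathrm{Gr}(1,\mathbb{R}^n)}\max\{|\underline{\lambda}(X,\Phi)-\underline{\lambda}(X,\Psi)|,|\overline{\lambda}(X,\Phi)-\overline{\lambda}(X,\Psi)|\},$$ $$d_{\mathbb{I}}(\Phi,\Psi)=\max\Big\{\sup_{x\in\mathcal{S}}\sup_{t\in\mathbb{I}}|(\Phi(t,t_-)-\Psi(t,t_-))x|,\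 \tilde d_{\mathbb{I}}(\Phi,\Psi)\Big\}.$$ *)

(* Defs.v *)
From HB Require Import structures.
From mathcomp Require Import all_boot all_order all_algebra.
From mathcomp Require Import all_classical all_reals all_analysis.

Set Implicit Arguments.
Unset Strict Implicit.
Unset Printing Implicit Defensive.

Import Order.TTheory GRing.Theory Num.Theory.
Import numFieldNormedType.Exports.

Local Open Scope classical_set_scope.
Local Open Scope ring_scope.

(* Vectors of R^n are column vectors; the topology of R^n and of R^n * R * R
   is the library's, which does not depend on the choice of a norm on R^n. *)
Record is_norm (R : realType) (n : nat) (N : 'cV[R]_n -> R) : Prop := IsNorm {
  norm_triangle : forall x y, N (x + y) <= N x + N y;
  norm_homogeneous : forall (a : R) x, N (a *: x) = `|a| * N x;
  norm_definite : forall x, N x = 0 -> x = 0 }.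

Definition unit_sphere (R : realType) (n : nat) (N : 'cV[R]_n -> R) :
  set 'cV[R]_n := [set x | N x = 1].

Definition opnorm (R : realType) (n : nat) (N : 'cV[R]_n -> R) (A : 'M[R]_n) :
  R := sup [set N (A *m x) | x in unit_sphere N].

(* Attained minimum and maximum: unlike inf and sup, these carry no
   information when the extremum is not attained. *)
Definition setmin (R : realType) (A : set R) : R :=
  get [set m | A m /\ lbound A m].

Definition setmax (R : realType) (A : set R) : R :=
  get [set m | A m /\ ubound A m].

Definition offdiag (R : realType) (I : set R) : set (R * R) :=
  [set p | [/\ I p.1, I p.2 & p.1 != p.2]].

(* A process is a total map R -> R -> 'M_n of which only the values on
   I * I are ever constrained or used. *)
Record linear_process (R : realType) (n : nat) (N : 'cV[R]_n -> R)
    (I : set R) (Phi : R -> R -> 'M[R]_n) : Prop := LinearProcess {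
  process_unit : forall t s, I t -> I s -> Phi t s \in unitmx;
  process_continuous :
    {within [set q : R * R * 'cV[R]_n | I q.1.1 /\ I q.1.2],
      continuous (fun q : R * R * 'cV[R]_n => Phi q.1.1 q.1.2 *m q.2)};
  process_id : forall t, I t -> Phi t t = 1%:M;
  process_comp : forall t s r, I t -> I s -> I r ->
    Phi t s *m Phi s r = Phi t r;
  process_lipschitz : forall s, I s -> exists L : R, forall t t', I t -> I t' ->
    opnorm N (Phi t s - Phi t' s) <= L * `|t - t'| }.

Definition Delta (R : realType) (f : R -> R) (p : R * R) : R :=
  (ln (f p.1) - ln (f p.2)) / (p.1 - p.2).

Definition rate_extends (R : realType) (n : nat) (N : 'cV[R]_n -> R)
    (I : set R) (Phi : R -> R -> 'M[R]_n) : set ('cV[R]_n * (R * R) -> R) :=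
  [set g | {within unit_sphere N `*` closure (offdiag I), continuous g} /\
     forall x p, unit_sphere N x -> offdiag I p ->
       g (x, p) = Delta (fun t => N (Phi t (setmin I) *m x)) p].

(* The set LP(I, R^n). *)
Definition LP (R : realType) (n : nat) (N : 'cV[R]_n -> R) (I : set R) :
  set (R -> R -> 'M[R]_n) :=
  [set Phi | linear_process N I Phi /\ rate_extends N I Phi !=set0].

(* Elements of rate_extends agree on unit_sphere N `*` closure (offdiag I),
   the only place where rate is evaluated below. *)
Definition rate (R : realType) (n : nat) (N : 'cV[R]_n -> R) (I : set R)
    (Phi : R -> R -> 'M[R]_n) : 'cV[R]_n * (R * R) -> R :=
  get (rate_extends N I Phi).

Definition Gr (R : realType) (n k : nat) : set {vspace 'cV[R]_n} :=
  [set X | \dim X = k].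
Arguments Gr : clear implicits.

Definition rates_on (R : realType) (n : nat) (N : 'cV[R]_n -> R) (I : set R)
    (Phi : R -> R -> 'M[R]_n) (X : {vspace 'cV[R]_n}) : set R :=
  [set rate N I Phi q | q in
    [set x | x \in X /\ unit_sphere N x] `*` closure (offdiag I)].

Definition lower_rate (R : realType) (n : nat) (N : 'cV[R]_n -> R) (I : set R)
    (X : {vspace 'cV[R]_n}) (Phi : R -> R -> 'M[R]_n) : R :=
  setmin (rates_on N I Phi X).

Definition upper_rate (R : realType) (n : nat) (N : 'cV[R]_n -> R) (I : set R)
    (X : {vspace 'cV[R]_n}) (Phi : R -> R -> 'M[R]_n) : R :=
  setmax (rates_on N I Phi X).

Definition lower_extremal_rate (R : realType) (n : nat) (N : 'cV[R]_n -> R)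
    (I : set R) (k : nat) (Phi : R -> R -> 'M[R]_n) : R :=
  setmax [set lower_rate N I X Phi | X in Gr R n k].

Definition upper_extremal_rate (R : realType) (n : nat) (N : 'cV[R]_n -> R)
    (I : set R) (k : nat) (Phi : R -> R -> 'M[R]_n) : R :=
  setmin [set upper_rate N I X Phi | X in Gr R n k].

Definition rate_dist (R : realType) (n : nat) (N : 'cV[R]_n -> R) (I : set R)
    (Phi Psi : R -> R -> 'M[R]_n) : R :=
  sup [set Num.max `|lower_rate N I X Phi - lower_rate N I X Psi|
                   `|upper_rate N I X Phi - upper_rate N I X Psi|
      | X in Gr R n 1].

Definition process_dist (R : realType) (n : nat) (N : 'cV[R]_n -> R)
    (I : set R) (Phi Psi : R -> R -> 'M[R]_n) : R :=
  Num.max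
    (sup [set sup [set N ((Phi t (setmin I) - Psi t (setmin I)) *m x)
                  | t in I]
         | x in unit_sphere N])
    (rate_dist N I Phi Psi).

(* Main.v *)
Require Import Defs.
From mathcomp Require Import all_boot all_order all_algebra.
From mathcomp Require Import all_classical all_reals all_analysis.
Import Order.TTheory GRing.Theory Num.Theory.
Import numFieldNormedType.Exports.
Local Open Scope classical_set_scope.
Local Open Scope ring_scope.
Set Implicit Arguments.
Unset Strict Implicit.
Unset Printing Implicit Defensive.

(** The difficulty is not the estimate but the fact that the extremal rates are
    attained: the estimate is a short argument on lines, while attainment
    rests on the compactness of the Grassmannian.

    Estimate.  Write [m(g, X)] for the minimum of a rate function [g] over
    the unit vectors of [X] and over the compact set of times.  If the minimum
    [m(h, X)] is reached at a unit vector [x] of [X], then it is at least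
    [m(h, <[x]>)], which is at least [m(g, <[x]>) - d] as soon as the minima
    of [g] and [h] on lines differ by at most [d]; and [m(g, <[x]>)] is at
    least [m(g, X)] because the line lies in [X] ([min_le_of_lines]).  Thus a
    bound on lines, such as the one given by [process_dist]
    ([line_rate_dist]), propagates to all subspaces, and then to the maximum
    over all [X] of dimension [k] ([max_min_dist]).  Exchanging the sign of
    the rate functions turns this into the statement on upper rates
    ([min_max_dist]).

    Attainment.  A subspace is encoded by the orthogonal projection onto it,
    for the standard Euclidean structure and not for the norm under study.
    The projections of trace [k] form a closed bounded set of matrices, hence
    a compact one ([compact_ortho_projections]), and their ranges are exactly
    the subspaces of dimension [k] ([Gr_ortho_projection]).  Along this
    encoding [m(g, X)] is upper semicontinuous, because a unit vector of [X]
    at which [g] is small can be moved to nearby subspaces by projecting and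
    normalizing it ([min_on_range_usc]); so its maximum is reached
    ([max_min_attained]). *)

(** * Subspaces as ranges of orthogonal projections *)

Definition mxrange (F : fieldType) (m n : nat) (A : 'M[F]_(m, n)) :
  {vspace 'cV[F]_m} := limg (linfun (mulmx A : 'cV[F]_n -> 'cV[F]_m)).

Lemma mxrangeP (F : fieldType) (m n : nat) (A : 'M[F]_(m, n)) x :
  reflect (exists y, x = A *m y) (x \in mxrange A).
Proof.
apply: (iffP memv_imgP) => [[y _ ->]|[y ->]]; exists y; rewrite ?memvf //.
  by rewrite lfunE.
by rewrite lfunE.
Qed.

Lemma mem_range_idem (F : fieldType) (n : nat) (P : 'M[F]_n) x :
  P *m P = P -> (x \in mxrange P) = (P *m x == x).
Proof.
move=> PP; apply/mxrangeP/eqP => [[y ->]|<-]; last by exists x.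
by rewrite mulmxA PP.
Qed.

Lemma dim_range_injective (F : fieldType) (m n : nat) (A : 'M[F]_(m, n))
  (B : 'M[F]_(n, m)) : B *m A = 1%:M -> \dim (mxrange A) = n.
Proof.
move=> BA; rewrite limg_dim_eq; last first.
  apply/eqP; rewrite -subv0; apply/subvP => x; rewrite memv_cap memvf /=.
  rewrite memv_ker lfunE /= memv0 => /eqP Ax0.
  by rewrite -[x]mul1mx -BA -mulmxA Ax0 mulmx0.
by rewrite dimvf /dim /= muln1.
Qed.

(** An idempotent factors as [C *m D] through its rank, with [D *m C] the
    identity; cyclicity of the trace then computes the rank.  This makes the
    dimension of the range a closed condition on the projection. *)
Lemma mxtrace_idem (F : fieldType) (n : nat) (P : 'M[F]_n) :
  P *m P = P -> \tr P = (\dim (mxrange P))%:R.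
Proof.
move=> PP; have := row_base_free P; have := col_base_full P.
move: (\rank P) (col_base P) (row_base P) (mulmx_base P).
move=> r C D defP fullC freeD.
have DC : D *m C = 1%:M.
  apply: (row_free_inj freeD); rewrite mul1mx.
  have /row_fullP [C' C'C] := fullC.
  rewrite -[LHS]mul1mx -C'C -!mulmxA defP [C *m (D *m P)]mulmxA defP PP.
  by rewrite -defP mulmxA C'C mul1mx.
have -> : mxrange P = mxrange C.
  apply/vspaceP => x; apply/mxrangeP/mxrangeP => [[y ->]|[y ->]].
    by exists (D *m y); rewrite mulmxA defP.
  by exists (C *m y); rewrite mulmxA -defP -(mulmxA C D) DC mulmx1.
by rewrite (dim_range_injective DC) -defP mxtrace_mulC DC mxtrace1.
Qed.

Lemma tr_mulmx_eq0 (R : realFieldType) (n : nat) (v : 'cV[R]_n) :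
  v^T *m v = 0 -> v = 0.
Proof.
move=> /matrixP/(_ 0 0); rewrite !mxE => vv.
apply/colP => i; rewrite mxE; apply/eqP; rewrite -sqrf_eq0 expr2.
move/eqP: vv; rewrite psumr_eq0 => [/allP /(_ i (mem_index_enum _))|j _].
  by rewrite mxE.
by rewrite mxE -expr2 sqr_ge0.
Qed.

(** The classical formula [C (C^T C)^-1 C^T], where the columns of [C] are a
    basis of [X]; the Gram matrix [C^T C] is invertible since
    [u C^T C = 0] forces the vector [C u^T] to have Euclidean length 0. *)
Lemma ortho_projection_onto (R : realFieldType) (n : nat)
    (X : {vspace 'cV[R]_n}) :
  exists P : 'M[R]_n, [/\ P^T = P, P *m P = P & mxrange P = X].
Proof.
pose k := \dim X; pose C : 'M[R]_(n, k) := \matrix_(i, j) (vbasis X)`_j i 0.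
have CE y : C *m y = \sum_i y i 0 *: (vbasis X)`_i.
  apply/colP => i; rewrite mxE summxE; apply: eq_bigr => j _.
  by rewrite !mxE mulrC.
have rangeC x : reflect (exists y, x = C *m y) (x \in X).
  apply: (iffP idP) => [/coord_vbasis ->|[y ->]].
    exists (\col_i coord (vbasis X) i x); rewrite CE.
    by apply: eq_bigr => i _; rewrite mxE.
  rewrite CE memv_suml // => i _; rewrite memvZ // vbasis_mem //.
  by rewrite mem_nth // size_tuple.
have Cinj (y : 'cV_k) : C *m y = 0 -> y = 0.
  rewrite CE => Cy0; apply/colP => i; rewrite mxE.
  exact: (freeP (basis_free (vbasisP X)) (fun i => y i 0) Cy0).
have Ginj : C^T *m C \in unitmx.
  rewrite -row_free_unit -kermx_eq0; apply/eqP/row_matrixP => i.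
  set u := row i _; rewrite row0.
  have uG : u *m (C^T *m C) = 0 by rewrite -row_mul mulmx_ker row0.
  apply: trmx_inj; rewrite trmx0; apply: Cinj; apply: tr_mulmx_eq0.
  by rewrite trmx_mul trmxK mulmxA -(mulmxA u) uG mul0mx.
set G := C^T *m C in Ginj.
have GT : (invmx G)^T = invmx G by rewrite trmx_inv trmx_mul trmxK.
have PC : C *m invmx G *m C^T *m C = C by rewrite -mulmxA mulmxKV.
exists (C *m invmx G *m C^T); split.
- by rewrite !trmx_mul trmxK GT mulmxA.
- by rewrite 2!mulmxA PC.
- apply/vspaceP => x; apply/mxrangeP/rangeC => [[y ->]|[y ->]].
    by exists (invmx G *m C^T *m y); rewrite !mulmxA.
  by exists (C *m y); rewrite mulmxA PC.
Qed.

(** * Compactness of the set of orthogonal projections *)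

Lemma mx_continuous_at (R : realType) (T : topologicalType) (m n : nat)
    (f : T -> 'M[R]_(m, n)) x :
  (forall i j, {for x, continuous (fun t => f t i j)}) ->
  {for x, continuous f}.
Proof.
move=> fc A [/= P Px sPA].
apply: filterS (_ : nbhs x [set t | forall i j, P i j (f t i j)]) => [t Pt|].
  exact: sPA.
apply: filter_forall => i; apply: filter_forall => j.
exact: fc (Px i j).
Qed.

Lemma continuous_at_sum (R : realType) (T : topologicalType) (J : finType)
    (f : J -> T -> R) x :
  (forall j, {for x, continuous (f j)}) ->
  {for x, continuous (fun t => \sum_j f j t)}.
Proof.
move=> fc; apply: (@cvg_big R J +%R 0 xpredT _ T (nbhs x)) => [|j _].
  exact: add_continuous.
exact: fc.
Qed.

Lemma mulmx_continuous_at (R : realType) (T : topologicalType) (m n p : nat)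
    (f : T -> 'M[R]_(m, n)) (g : T -> 'M[R]_(n, p)) x :
  {for x, continuous f} -> {for x, continuous g} ->
  {for x, continuous (fun t => f t *m g t)}.
Proof.
move=> fc gc; apply: mx_continuous_at => i j.
have coord q r (h : T -> 'M[R]_(q, r)) k l : {for x, continuous h} ->
    {for x, continuous (fun t => h t k l)}.
  move=> hc; apply: (@continuous_comp _ _ _ h (fun M => M k l) x hc).
  exact: coord_continuous.
rewrite (_ : (fun t => (f t *m g t) i j) =
  (fun t => \sum_k f t i k * g t k j)); last by apply/funext => ?; rewrite mxE.
by apply: continuous_at_sum => k; apply: cvgM; exact: coord.
Qed.

(** Flattening preserves the sup norm, which transports the Heine-Borel theorem
    from row vectors to matrices. *)
Lemma mxvec_mx_norm (R : realType) (m n : nat) (v : 'rV[R]_(m * n)) :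
  `|(vec_mx v : 'M[R]_(m, n))| = `|v|.
Proof.
rewrite /Num.norm /= !mx_normrE; apply/le_anti/andP; split.
  apply/bigmax_leP; split=> [|[i j] _ /=]; first by rewrite bigmax_ge_id.
  rewrite mxE.
  exact: (le_bigmax _ (fun k => `|v k.1 k.2|) (0, mxvec_index i j)).
apply/bigmax_leP; split=> [|[i j] _ /=]; first by rewrite bigmax_ge_id.
rewrite ord1; case/mxvec_indexP: j => k l.
have -> : v 0 (mxvec_index k l) = vec_mx v k l by rewrite mxE.
exact: (le_bigmax _ (fun k => `|vec_mx v k.1 k.2|) (k, l)).
Qed.

Lemma mx_bounded_closed_compact (R : realType) (m n : nat)
    (A : set 'M[R]_(m, n)) : bounded_set A -> closed A -> compact A.
Proof.
move=> Abnd Acl; have vc : continuous (@vec_mx R m n).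
  move=> v; apply: mx_continuous_at => i j.
  rewrite (_ : (fun u : 'rV_(m * n) => vec_mx u i j) =
    (fun u : 'rV_(m * n) => u 0 (mxvec_index i j))); last first.
    by apply/funext => ?; rewrite mxE.
  exact: coord_continuous.
have -> : A = @vec_mx R m n @` (vec_mx @^-1` A).
  apply/seteqP; split=> [M AM|_ [v Av <-] //].
  by exists (mxvec M); rewrite /= mxvecK.
apply: continuous_compact; first exact: continuous_subspaceT.
apply: bounded_closed_compact; last exact: preimage_closed.
move: Abnd; rewrite /= /bounded_near; apply: filterS => M MA v /= /MA /=.
by rewrite mxvec_mx_norm.
Qed.

Lemma coord_le_mx_norm (R : realType) (m n : nat) (A : 'M[R]_(m, n)) i j :
  `|A i j| <= `|A|.
Proof.
rewrite [leRHS]/Num.norm /= mx_normrE.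
exact: (le_bigmax _ (fun k => `|A k.1 k.2|) (i, j)).
Qed.

Definition ortho_projections (R : realType) (n k : nat) : set 'M[R]_n :=
  [set P | [/\ P^T = P, P *m P = P & \tr P = k%:R]].

(** Symmetry and idempotence give [\tr P = \sum_i \sum_j P i j ^+ 2], so fixing
    the trace bounds every entry. *)
Lemma compact_ortho_projections (R : realType) (n k : nat) :
  compact (@ortho_projections R n k).
Proof.
apply: mx_bounded_closed_compact.
  rewrite /bounded_near /=; near=> M => P [PT PP Pk].
  (* An integer bound dominating sqrt k, so that no square root is needed. *)
  apply: le_trans (_ : k.+1%:R <= M); last first.
    by near: M; apply: nbhs_pinfty_ge; rewrite realn.
  rewrite /Num.norm /= mx_normrE; apply/bigmax_leP; split=> [|[i j] _ /=] //.
  have sumP : \sum_i \sum_j P i j ^+ 2 = k%:R.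
    rewrite -Pk -{2}PP; apply: eq_bigr => a _; rewrite mxE.
    by apply: eq_bigr => b _; rewrite -{3}PT mxE expr2.
  have Pij : P i j ^+ 2 <= k%:R.
    rewrite -sumP (bigD1 i) //= (bigD1 j) //= -addrA lerDl.
    rewrite addr_ge0 ?sumr_ge0 //.
      by move=> *; exact: sqr_ge0.
    by move=> *; apply: sumr_ge0 => *; exact: sqr_ge0.
  rewrite -(@ler_sqr R) ?nnegrE //; rewrite real_normK ?num_real //.
  rewrite (le_trans Pij) // -natrX ler_nat (leq_trans (leqnSn k)) //.
  by rewrite leq_pmulr.
have idc : continuous (@id 'M[R]_n) by move=> ?.
have cl0 p (f : 'M[R]_n -> 'M[R]_p) :
    (forall P, {for P, continuous f}) -> closed (f @^-1` [set 0]).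
  move=> fc; apply: preimage_closed => [x _|]; first exact: fc.
  apply: accessible_closed_set1; apply: hausdorff_accessible.
  exact: norm_hausdorff.
rewrite (_ : ortho_projections k =
   (fun P => P^T - P) @^-1` [set 0] `&`
   ((fun P => P *m P - P) @^-1` [set 0] `&`
   (fun P => (\tr P)%:M - k%:R%:M : 'M[R]_1) @^-1` [set 0])).
  apply: closedI; [|apply: closedI]; apply: cl0 => P.
  - apply: (@continuousB R _ _ (fun Q : 'M[R]_n => Q^T) id P); last exact: idc.
    apply: mx_continuous_at => i j.
    rewrite (_ : (fun Q : 'M[R]_n => Q^T i j) =
      (fun Q : 'M[R]_n => Q j i)); last by apply/funext => ?; rewrite mxE.
    exact: coord_continuous.
  - apply: (@continuousB R _ _ (fun Q : 'M[R]_n => Q *m Q) id P);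
      last exact: idc.
    by apply: mulmx_continuous_at; exact: idc.
  - apply: (@continuousB R _ _ (fun Q : 'M[R]_n => (\tr Q)%:M)
      (fun=> k%:R%:M) P);
      last exact: cst_continuous.
    apply: mx_continuous_at => i j; rewrite !ord1.
    rewrite (_ : (fun Q : 'M[R]_n => (\tr Q)%:M 0 0 : R) =
      (fun Q : 'M[R]_n => \sum_l Q l l)); last first.
      by apply/funext => ?; rewrite mxE eqxx.
    by apply: continuous_at_sum => l; exact: coord_continuous.
apply/seteqP; split=> P /=.
  by move=> [-> -> ->]; rewrite !subrr.
move=> [/subr0_eq PT [/subr0_eq PP /subr0_eq/matrixP/(_ 0 0)]].
by rewrite !mxE eqxx.
Unshelve. all: by end_near.
Qed.

(** * Norms on column vectors *)

Section NormOnColumns.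
Variables (R : realType) (n : nat) (N : 'cV[R]_n -> R).
Hypothesis N_norm : is_norm N.

Lemma norm_at0 : N 0 = 0.
Proof. by rewrite -(scale0r 0) (norm_homogeneous N_norm) normr0 mul0r. Qed.

Lemma norm_opp x : N (- x) = N x.
Proof. by rewrite -scaleN1r (norm_homogeneous N_norm) normrN1 mul1r. Qed.

Lemma norm_nonneg x : 0 <= N x.
Proof.
have := norm_triangle N_norm x (- x).
by rewrite subrr norm_at0 norm_opp -mulr2n pmulrn_lge0.
Qed.

Lemma unit_sphere_neq0 x : unit_sphere N x -> x != 0.
Proof.
rewrite /unit_sphere /= => Nx1; apply/eqP => x0.
by move/eqP: Nx1; rewrite x0 norm_at0 eq_sym oner_eq0.
Qed.

Lemma norm_normalized x : x != 0 -> N ((N x)^-1 *: x) = 1.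
Proof.
move=> x0; have Nx0 : N x != 0.
  by apply: contra_neq x0 => /(norm_definite N_norm).
by rewrite (norm_homogeneous N_norm) ger0_norm ?invr_ge0 ?norm_nonneg // mulVf.
Qed.

Lemma norm_le_mx_norm : exists C : R, 0 < C /\ forall x, N x <= C * `|x|.
Proof.
have Nsum (F : 'I_n -> 'cV[R]_n) : N (\sum_i F i) <= \sum_i N (F i).
  elim/big_ind2: _ => [|a b c d ab cd|//]; first by rewrite norm_at0.
  exact: le_trans (norm_triangle N_norm _ _) (lerD ab cd).
exists (1 + \sum_i N (delta_mx i 0)); split=> [|x].
  by rewrite ltr_pwDl // sumr_ge0 // => i _; exact: norm_nonneg.
rewrite {1}[x]matrix_sum_delta; under eq_bigr do rewrite big_ord1.
apply: le_trans (Nsum _) _; rewrite mulrDl mul1r mulr_suml ler_wpDl //.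
apply: ler_sum => i _; rewrite (norm_homogeneous N_norm) mulrC.
by rewrite ler_wpM2l ?norm_nonneg ?coord_le_mx_norm.
Qed.

(** A norm is Lipschitz for the sup norm, hence continuous for the topology of
    matrices. *)
Lemma norm_continuous_cV : continuous N.
Proof.
move=> x; have [C [C0 NC]] := norm_le_mx_norm.
have Nlip a b : N a - N b <= C * `|a - b|.
  rewrite lerBlDl; apply: le_trans (lerD (lexx _) (NC _)).
  by rewrite -{1}(subrKC b a); exact: norm_triangle.
apply/(@cvgrPdist_lt _ _ _ (nbhs x)) => e e0; near=> y.
apply: (@le_lt_trans _ _ (C * `|x - y|)).
  rewrite ler_norml lerNl opprB Nlip andbT distrC.
  exact: Nlip.
rewrite -ltr_pdivlMl //; near: y.
by apply: cvgr_dist_lt => //; rewrite mulr_gt0 ?invr_gt0.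
Unshelve. all: by end_near.
Qed.

(** Equivalence of norms: [N] has a positive minimum on the sphere of the sup
    norm, whose inverse bounds the unit sphere of [N]. *)
Lemma compact_unit_sphere : compact (unit_sphere N).
Proof.
have clS : closed (unit_sphere N).
  apply: (@preimage_closed _ _ N [set 1]) => [x _|].
    exact: norm_continuous_cV.
  exact: closed_eq.
apply: mx_bounded_closed_compact => //.
have [[z Sz]|S0] := pselect (exists x, unit_sphere N x); last first.
  by exists 0; split=> [|M _ x Sx]; [exact: real0|case: S0; exists x].
pose B := [set x : 'cV[R]_n | `|x| = 1].
have cB : compact B.
  apply: mx_bounded_closed_compact.
    rewrite /= /bounded_near; near=> M => x /= ->.
    by near: M; apply: nbhs_pinfty_ge; rewrite real1.
  apply: (@preimage_closed _ _ (fun x : 'cV[R]_n => `|x|) [set 1]) => [x _|].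
    exact: norm_continuous.
  exact: closed_eq.
have B_normalized x : x != 0 -> B (`|x|^-1 *: x).
  by move=> x0; rewrite /B /= normrZ normfV normr_id mulVf ?normr_eq0.
have [|c Bc cmin] := @compact_EVT_min _ R N B _ cB
   (continuous_subspaceT norm_continuous_cV).
  by exists (`|z|^-1 *: z); exact/B_normalized/unit_sphere_neq0.
have c0 : c != 0.
  apply/eqP => c0; move/set_mem/eqP: Bc.
  by rewrite c0 normr0 eq_sym oner_eq0.
have Nc : 0 < N c.
  rewrite lt_neqAle norm_nonneg andbT eq_sym.
  by apply: contra_neq c0 => /(norm_definite N_norm).
rewrite /= /bounded_near; near=> M => x Sx /=.
apply: (@le_trans _ _ (N c)^-1); last first.
  by near: M; apply: nbhs_pinfty_ge; rewrite num_real.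
have x_gt0 : 0 < `|x| by rewrite normr_gt0 unit_sphere_neq0.
have := cmin _ (mem_set (B_normalized _ (unit_sphere_neq0 Sx))).
rewrite (norm_homogeneous N_norm) Sx mulr1 normfV normr_id => le_c.
by rewrite -(invrK `|x|) lef_pV2 ?posrE ?invr_gt0.
Unshelve. all: by end_near.
Qed.

End NormOnColumns.

(** * Attained extrema *)

(** The superlevel sets of the values of [f] form a filter base on [K]; upper
    semicontinuity prevents [f] from being below any of its values at a cluster
    point of this filter. *)
Lemma usc_attains_max (R : realType) (T : topologicalType) (K : set T)
    (f : T -> R) :
  compact K -> K !=set0 ->
  (forall x r, K x -> f x < r -> \forall y \near x, K y -> f y < r) ->
  exists2 x, K x & forall y, K y -> f y <= f x.
Proof.
move=> cK [x0 Kx0] usc.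
pose U a := [set y | K y /\ f a <= f y].
have FF : ProperFilter (filter_from K U).
  apply: filter_from_proper => [|a Ka]; last by exists a.
  apply: filter_from_filter; first by exists x0.
  move=> a b Ka Kb; have [ab|/ltW ba] := leP (f a) (f b).
    exists b => // y [Ky by_]; split; split=> //; exact: le_trans by_.
  by exists a => // y [Ky ay]; split; split=> //; exact: le_trans ay.
have [|x [Kx clx]] := cK _ FF; first by exists x0 => // y [].
exists x => // y Ky; rewrite leNgt; apply/negP => /(usc _ _ Kx) near_lt.
have Uy : filter_from K U (U y) by exists y.
have [z [[Kz yz]]] := clx _ _ Uy near_lt.
by move=> /(_ Kz); rewrite ltNge yz.
Qed.

Lemma setmin_unique (R : realType) (A : set R) m :
  A m -> lbound A m -> setmin A = m.
Proof.
move=> Am lbm; rewrite /setmin; apply: get_unique => // y [Ay lby].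
by apply/le_anti/andP; split; [exact: lby | exact: lbm].
Qed.

Lemma setmax_unique (R : realType) (A : set R) m :
  A m -> ubound A m -> setmax A = m.
Proof.
move=> Am ubm; rewrite /setmax; apply: get_unique => // y [Ay uby].
by apply/le_anti/andP; split; [exact: ubm | exact: uby].
Qed.

Lemma compact_setmin (R : realType) (A : set R) :
  compact A -> A !=set0 -> A (setmin A) /\ lbound A (setmin A).
Proof.
move=> cA A0; have idc : continuous (@id R) by move=> ?.
have [c /set_mem Ac cmin] := compact_EVT_min A0 cA (continuous_subspaceT idc).
have lbc : lbound A c by move=> x Ax; exact/cmin/mem_set.
by rewrite (setmin_unique Ac lbc).
Qed.

Lemma compact_setmax (R : realType) (A : set R) :
  compact A -> A !=set0 -> A (setmax A) /\ ubound A (setmax A).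
Proof.
move=> cA A0; have idc : continuous (@id R) by move=> ?.
have [c /set_mem Ac cmax] := compact_EVT_max A0 cA (continuous_subspaceT idc).
have ubc : ubound A c by move=> x Ax; exact/cmax/mem_set.
by rewrite (setmax_unique Ac ubc).
Qed.

Lemma setmin_opp (R : realType) (A : set R) :
  A (setmax A) /\ ubound A (setmax A) ->
  setmin [set - x | x in A] = - setmax A.
Proof.
move=> [Am ubm]; apply: setmin_unique; first by exists (setmax A).
by move=> _ [x Ax <-]; rewrite lerN2; exact: ubm.
Qed.

(** * Extrema of rate functions on subspaces *)

Lemma dimv_gt0_unit_vector (R : realType) (n : nat) (N : 'cV[R]_n -> R)
    (X : {vspace 'cV[R]_n}) :
  is_norm N -> (0 < \dim X)%N -> exists x, x \in X /\ unit_sphere N x.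
Proof.
move=> N_norm; rewrite lt0n dimv_eq0 -vpick0 => v0.
exists ((N (vpick X))^-1 *: vpick X).
by rewrite memvZ ?memv_pick //; split=> //; exact: norm_normalized.
Qed.

(** Parametrizes the Grassmannian by a compact set of matrices: the trace
    condition pins the dimension by [mxtrace_idem]. *)
Lemma Gr_ortho_projection (R : realType) (n k : nat) (X : {vspace 'cV[R]_n}) :
  Gr R n k X <-> exists2 P, ortho_projections k P & mxrange P = X.
Proof.
split=> [Xk|[P [_ PP Pk] <-]].
  have [P [PT PP PX]] := ortho_projection_onto X; exists P => //; split=> //.
  by rewrite mxtrace_idem // PX Xk.
by have := mxtrace_idem PP; rewrite Pk => /eqP; rewrite eqr_nat => /eqP.
Qed.

Lemma Gr_nonempty (R : realType) (n k : nat) : (k <= n)%N -> Gr R n k !=set0.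
Proof.
move=> kn; exists (mxrange (pid_mx k : 'M[R]_(n, k))).
apply: (@dim_range_injective _ _ _ _ (pid_mx k)).
by rewrite pid_mx_id // pid_mx_1.
Qed.

Lemma closed_vspace (R : realType) (n : nat) (X : {vspace 'cV[R]_n}) :
  closed [set x | x \in X].
Proof.
have [P [_ PP <-]] := ortho_projection_onto X.
rewrite (_ : [set x | _] = (fun x : 'cV[R]_n => P *m x - x) @^-1` [set 0]).
  apply: preimage_closed => [x _|].
    apply: (@continuousB R _ _ (fun x : 'cV[R]_n => P *m x) id x); last by [].
    by apply: mulmx_continuous_at => //; exact: cst_continuous.
  apply: accessible_closed_set1; apply: hausdorff_accessible.
  exact: norm_hausdorff.
apply/seteqP; split=> x /=; rewrite mem_range_idem //.
  by move/eqP => ->; rewrite subrr.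
by move/subr0_eq => ->.
Qed.

Section Grassmannian.
Variables (R : realType) (n : nat) (N : 'cV[R]_n -> R).
Hypothesis N_norm : is_norm N.
Variables (T : topologicalType) (K : set T).
Hypotheses (cK : compact K) (K0 : K !=set0).

Definition values_on (g : 'cV[R]_n * T -> R) (X : {vspace 'cV[R]_n}) : set R :=
  [set g q | q in [set x | x \in X /\ unit_sphere N x] `*` K].

Definition continuous_on_sphere (g : 'cV[R]_n * T -> R) :=
  {within unit_sphere N `*` K, continuous g}.

Lemma compact_values_on g X : continuous_on_sphere g -> compact (values_on g X).
Proof.
move=> gc; apply: continuous_compact.
  apply: continuous_subspaceW gc => -[x p] [[_ Sx] Kp]; by split.
apply: compact_setX => //.
rewrite (_ : [set x | _] = unit_sphere N `&` [set x | x \in X]).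
  apply: compact_closedI; first exact: compact_unit_sphere.
  exact: closed_vspace.
by apply/seteqP; split=> x [].
Qed.

Lemma values_on_nonempty g (X : {vspace 'cV[R]_n}) :
  (0 < \dim X)%N -> values_on g X !=set0.
Proof.
move=> X0; have [x Xx] := dimv_gt0_unit_vector N_norm X0.
by case: K0 => p Kp; exists (g (x, p)), (x, p).
Qed.

Lemma min_values_on g X : continuous_on_sphere g -> (0 < \dim X)%N ->
  values_on g X (setmin (values_on g X)) /\
  lbound (values_on g X) (setmin (values_on g X)).
Proof.
move=> gc X0; apply: compact_setmin; first exact: compact_values_on.
exact: values_on_nonempty.
Qed.

Lemma max_values_on g X : continuous_on_sphere g -> (0 < \dim X)%N ->
  values_on g X (setmax (values_on g X)) /\
  ubound (values_on g X) (setmax (values_on g X)).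
Proof.
move=> gc X0; apply: compact_setmax; first exact: compact_values_on.
exact: values_on_nonempty.
Qed.

Lemma values_on_oppE g X :
  values_on (fun q => - g q) X = [set - r | r in values_on g X].
Proof.
apply/seteqP; split=> [_ [q Dq <-]|_ [_ [q Dq <-] <-]]; last by exists q.
by exists (g q) => //; exists q.
Qed.

Lemma continuous_on_sphere_opp g :
  continuous_on_sphere g -> continuous_on_sphere (fun q => - g q).
Proof. by move=> gc x; apply: continuousN; exact: gc. Qed.

(** If the minimum on the range of [P] is taken at a unit vector [x], the
    normalized projection of [x] by [Q] is, for [Q] near [P], a unit vector of
    the range of [Q] close to [x], so the minimum there is also below [r]. *)
Lemma min_on_range_usc g k (P : 'M[R]_n) r :
  (0 < k)%N -> continuous_on_sphere g ->
  ortho_projections k P -> setmin (values_on g (mxrange P)) < r ->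
  \forall Q \near P, ortho_projections k Q ->
    setmin (values_on g (mxrange Q)) < r.
Proof.
move=> k0 gc KP.
have dimP (Q : 'M[R]_n) :
    ortho_projections k Q -> (0 < \dim (mxrange Q))%N.
  move=> KQ; rewrite (_ : \dim _ = k) //.
  by apply/Gr_ortho_projection; exists Q.
have [[[x p] [/= [Px Sx] Kp] <-] _] := min_values_on gc (dimP P KP) => gr.
have {}Px : P *m x = x by apply/eqP; rewrite -mem_range_idem //; case: KP.
pose u (Q : 'M[R]_n) := (N (Q *m x))^-1 *: (Q *m x).
have mulc : {for P, continuous (fun Q : 'M[R]_n => Q *m x)}.
  by apply: mulmx_continuous_at => //; exact: cst_continuous.
have Nc : {for P, continuous (fun Q : 'M[R]_n => N (Q *m x))}.
  by apply: (cvg_comp _ _ mulc); exact: norm_continuous_cV.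
have NP : N (P *m x) = 1 by rewrite Px.
have ic : {for P, continuous (fun Q : 'M[R]_n => (N (Q *m x))^-1)}.
  by apply: continuousV => //; rewrite NP oner_neq0.
have uc : {for P, continuous u} by exact: cvgZ ic mulc.
have uP : u P = x by rewrite /u NP invr1 scale1r.
have g_near : \forall q \near (x, p), (unit_sphere N `*` K) q -> g q < r.
  have /subspace_continuousP gw := gc.
  have gxp : g @ within (unit_sphere N `*` K) (nbhs (x, p)) --> g (x, p).
    exact: (gw (x, p) (conj Sx Kp)).
  exact: cvgr_lt gxp r gr.
have gu_near : \forall Q \near P,
    (unit_sphere N `*` K) (u Q, p) -> g (u Q, p) < r.
  have cpair : (u Q, p) @[Q --> P] --> (x, p).
    have ux : u Q @[Q --> P] --> x by rewrite -[X in _ --> X]uP.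
    exact: (@cvg_pair _ _ _ (nbhs P) (nbhs x) (nbhs p) _ _ _ u (fun=> p) ux
      (cvg_cst p)).
  exact: (cpair _ g_near).
have N_near : \forall Q \near P, 0 < N (Q *m x).
  have N1 : N (Q *m x) @[Q --> P] --> (1 : R) by rewrite -NP; exact: Nc.
  exact: cvgr_gt N1 0 ltr01.
near=> Q => KQ.
have Qx0 : Q *m x != 0.
  apply: contraTneq (_ : 0 < N (Q *m x)) => [->|].
    by rewrite norm_at0 ?ltxx.
  by near: Q.
have Su : unit_sphere N (u Q) by exact: norm_normalized.
apply: le_lt_trans (_ : g (u Q, p) < r); last first.
  have : (unit_sphere N `*` K) (u Q, p) by [].
  by near: Q; exact: gu_near.
have [_ lb] := min_values_on gc (dimP Q KQ); apply: lb.
exists (u Q, p) => //; split=> //=; split=> //.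
by rewrite memvZ //; apply/mxrangeP; exists x.
Unshelve. all: by end_near.
Qed.

Lemma max_min_attained g k : (0 < k <= n)%N -> continuous_on_sphere g ->
  exists2 X, Gr R n k X & forall Y, Gr R n k Y ->
    setmin (values_on g Y) <= setmin (values_on g X).
Proof.
move=> /andP[k0 kn] gc.
have [|||P KP Pmax] := @usc_attains_max R _ (@ortho_projections R n k)
    (fun P => setmin (values_on g (mxrange P))).
- exact: compact_ortho_projections.
- have [X /Gr_ortho_projection [P KP _]] := Gr_nonempty R kn.
  by exists P.
- by move=> P r KP; exact: min_on_range_usc.
exists (mxrange P); first by apply/Gr_ortho_projection; exists P.
by move=> Y /Gr_ortho_projection [Q KQ <-]; exact: Pmax.
Qed.

(** A minimizing unit vector for [h] on [X] spans a line in [X] on which the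
    minimum of [h] is already that of [X]. *)
Lemma min_le_of_lines g h d k X :
  (0 < k)%N -> continuous_on_sphere g -> continuous_on_sphere h ->
  (forall L, Gr R n 1 L ->
     `|setmin (values_on g L) - setmin (values_on h L)| <= d) ->
  Gr R n k X -> setmin (values_on g X) <= setmin (values_on h X) + d.
Proof.
move=> k0 gc hc lines Xk.
have X0 : (0 < \dim X)%N by rewrite Xk.
have [[[x p] [[/= Xx Sx] Kp] <-] _] := min_values_on hc X0.
have x0 : x != 0 by exact: unit_sphere_neq0 Sx.
have L1 : Gr R n 1 <[x]>%VS by rewrite /Gr /= dim_vline x0.
have L0 : (0 < \dim <[x]>)%N by rewrite L1.
have hL : setmin (values_on h <[x]>%VS) <= h (x, p).
  have [_ lb] := min_values_on hc L0; apply: lb; exists (x, p) => //.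
  by split=> //=; split=> //; exact: memv_line.
have gL : setmin (values_on g X) <= setmin (values_on g <[x]>%VS).
  have [[[y q] [[/= Ly Sy] Kq] <-] _] := min_values_on gc L0.
  have [_ lb] := min_values_on gc X0; apply: lb; exists (y, q) => //.
  by split=> //=; split=> //; move/vlineP: Ly => [a ->]; exact: memvZ.
apply: le_trans gL _; apply: le_trans (lerD hL (lexx d)).
by rewrite -lerBlDl; exact: le_trans (ler_norm _) (lines _ L1).
Qed.

Lemma max_min_dist g h d k :
  (0 < k <= n)%N -> continuous_on_sphere g -> continuous_on_sphere h ->
  (forall L, Gr R n 1 L ->
     `|setmin (values_on g L) - setmin (values_on h L)| <= d) ->
  `|setmax [set setmin (values_on g X) | X in Gr R n k]
    - setmax [set setmin (values_on h X) | X in Gr R n k]| <= d.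
Proof.
move=> /[dup] kn /andP[k0 _] gc hc lines.
have extr f : continuous_on_sphere f -> exists2 X, Gr R n k X &
    (forall Y, Gr R n k Y ->
       setmin (values_on f Y) <= setmin (values_on f X)) /\
    setmax [set setmin (values_on f Z) | Z in Gr R n k] =
      setmin (values_on f X).
  move=> fc; have [X Xk Xmax] := max_min_attained kn fc.
  exists X => //; split=> //; apply: setmax_unique; first by exists X.
  by move=> _ [Y Yk <-]; exact: Xmax.
have [X Xk [Xmax ->]] := extr g gc; have [Y Yk [Ymax ->]] := extr h hc.
rewrite ler_distl lerBlDr.
apply/andP; split.
  apply: le_trans (min_le_of_lines k0 hc gc _ Yk) (lerD (Xmax _ Yk) (lexx d)).
  by move=> L L1; rewrite distrC lines.
exact: le_trans (min_le_of_lines k0 gc hc lines Xk) (lerD (Ymax _ Xk) (lexx d)).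
Qed.

Lemma setmax_valuesE g X : continuous_on_sphere g -> (0 < \dim X)%N ->
  setmax (values_on g X) = - setmin (values_on (fun q => - g q) X).
Proof.
move=> gc X0; rewrite values_on_oppE setmin_opp ?opprK //.
exact: max_values_on.
Qed.

(** Passing to opposite functions exchanges minima and maxima and preserves
    distances. *)
Lemma min_max_dist g h d k :
  (0 < k <= n)%N -> continuous_on_sphere g -> continuous_on_sphere h ->
  (forall L, Gr R n 1 L ->
     `|setmax (values_on g L) - setmax (values_on h L)| <= d) ->
  `|setmin [set setmax (values_on g X) | X in Gr R n k]
    - setmin [set setmax (values_on h X) | X in Gr R n k]| <= d.
Proof.
move=> /[dup] kn /andP[k0 _] gc hc lines.
have oppE f : continuous_on_sphere f ->
    setmin [set setmax (values_on f X) | X in Gr R n k] =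
    - setmax [set setmin (values_on (fun q => - f q) X) | X in Gr R n k].
  move=> fc; rewrite -setmin_opp.
    congr setmin; apply/seteqP; split=> [_ [X Xk <-]|_ [_ [X Xk <-] <-]].
      exists (setmin (values_on (fun q => - f q) X)); first by exists X.
      by rewrite setmax_valuesE ?Xk.
    by exists X => //; rewrite setmax_valuesE ?Xk.
  have [X Xk Xmax] := max_min_attained kn (continuous_on_sphere_opp fc).
  have ubX : ubound [set setmin (values_on (fun q => - f q) Y) | Y in Gr R n k]
      (setmin (values_on (fun q => - f q) X)).
    by move=> _ [Y Yk <-]; exact: Xmax.
  by rewrite (setmax_unique _ ubX); [split=> //; exists X | exists X].
rewrite !oppE // -opprD normrN; apply: max_min_dist => //;
  try exact: continuous_on_sphere_opp.
move=> L L1; have := lines L L1.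
by rewrite !setmax_valuesE ?L1 // -opprD normrN.
Qed.

Lemma values_on_bounded g : continuous_on_sphere g -> exists M, forall X r,
  values_on g X r -> `|r| <= M.
Proof.
move=> gc; have : compact [set g q | q in unit_sphere N `*` K].
  apply: continuous_compact => //; apply: compact_setX => //.
  exact: compact_unit_sphere.
move=> /compact_bounded [M [_ gM]]; exists (M + 1) => X _ [q [[_ Sq] Kq] <-].
by apply: (gM (M + 1)); [rewrite ltrDl | exists q].
Qed.

End Grassmannian.

(** * Rates of linear processes *)

Lemma compact_closure_offdiag (R : realType) (I : set R) :
  compact I -> compact (closure (offdiag I)).
Proof.
move=> cI; have cII := compact_setX cI cI.
apply: (subclosed_compact _ cII); first exact: closed_closure.
have : closed (I `*` I) by apply: compact_closed cII; exact: norm_hausdorff.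
rewrite closure_id => ->; apply: closureS => p [] //.
Qed.

Lemma closure_offdiag_nonempty (R : realType) (I : set R) :
  compact I -> setmin I < setmax I -> closure (offdiag I) !=set0.
Proof.
move=> cI lt_I; have [I0|] := eqVneq I set0.
  move: lt_I; rewrite (_ : setmin I = setmax I) ?ltxx // /setmin /setmax.
  by congr get; apply/seteqP; rewrite I0; split=> x [].
move=> /set0P I0; exists (setmin I, setmax I); apply: subset_closure.
have [Imin _] := compact_setmin cI I0; have [Imax _] := compact_setmax cI I0.
by split=> //=; rewrite lt_eqF.
Qed.

(** The distance is defined by a supremum, which is an upper bound only for a
    bounded set; here boundedness comes from that of continuous functions on a
    compact set. *)
Lemma line_rate_dist (R : realType) (n : nat) (N : 'cV[R]_n -> R)
    (I : set R) (Phi Psi : R -> R -> 'M[R]_n) L :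
  is_norm N -> compact I -> setmin I < setmax I ->
  LP N I Phi -> LP N I Psi -> Gr R n 1 L ->
  Num.max `|lower_rate N I L Phi - lower_rate N I L Psi|
          `|upper_rate N I L Phi - upper_rate N I L Psi|
    <= process_dist N I Phi Psi.
Proof.
move=> N_norm cI lt_I [_ /getPex [Phic _]] [_ /getPex [Psic _]] L1.
have cK := compact_closure_offdiag cI.
have K0 := closure_offdiag_nonempty cI lt_I.
apply: le_trans (_ : rate_dist N I Phi Psi <= _); last first.
  by rewrite le_max lexx orbT.
apply: ub_le_sup; last by exists L.
have [M PhiM] := values_on_bounded N_norm cK Phic.
have [M' PsiM] := values_on_bounded N_norm cK Psic.
exists (M + M') => _ [X X1 <-].
have X0 : (0 < \dim X)%N by rewrite X1.
have [PhiL _] := min_values_on N_norm cK K0 Phic X0.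
have [PsiL _] := min_values_on N_norm cK K0 Psic X0.
have [PhiU _] := max_values_on N_norm cK K0 Phic X0.
have [PsiU _] := max_values_on N_norm cK K0 Psic X0.
rewrite ge_max; apply/andP; split; apply: le_trans (ler_normB _ _) _.
  by apply: lerD; [exact: PhiM PhiL | exact: PsiM PsiL].
by apply: lerD; [exact: PhiM PhiU | exact: PsiM PsiU].
Qed.

Theorem lemma2p20 (R : realType) (n : nat) (n_ge1 : (1 <= n)%N)
    (N : 'cV[R]_n -> R) (N_norm : is_norm N)
    (I : set R) (I_compact : compact I) (I_nontrivial : setmin I < setmax I)
    (k : nat) (k_range : (1 <= k <= n)%N) :
  (forall Phi Psi : R -> R -> 'M[R]_n, LP N I Phi -> LP N I Psi ->
     `|lower_extremal_rate N I k Phi - lower_extremal_rate N I k Psi|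
       <= process_dist N I Phi Psi) /\
  (forall Phi Psi : R -> R -> 'M[R]_n, LP N I Phi -> LP N I Psi ->
     `|upper_extremal_rate N I k Phi - upper_extremal_rate N I k Psi|
       <= process_dist N I Phi Psi).
Proof.
have cK := compact_closure_offdiag I_compact.
have K0 := closure_offdiag_nonempty I_compact I_nontrivial.
split=> Phi Psi LPhi LPsi;
  have [[_ /getPex [Phic _]] [_ /getPex [Psic _]]] := (LPhi, LPsi).
- apply: (max_min_dist N_norm cK K0 k_range Phic Psic) => L L1.
  have := line_rate_dist N_norm I_compact I_nontrivial LPhi LPsi L1.
  by rewrite ge_max => /andP[].
- apply: (min_max_dist N_norm cK K0 k_range Phic Psic) => L L1.
  have := line_rate_dist N_norm I_compact I_nontrivial LPhi LPsi L1.
  by rewrite ge_max => /andP[].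
Qed.
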